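(* For all real $x>0$, $y>0$ the following properties hold. (a) $\displaystyle \mathrm{vol}(\mathrm{D}(x,y)) = \sum_{n=0}^{\infty}\frac{x^n y^n}{n!\,n!}$. (b) $\mathrm{vol}(\mathrm{D}(x,y)) = \mathrm{vol}(\mathrm{D}(y,x))$. (c) $\mathrm{vol}(\mathrm{D}(ax,a^{-1}y)) = \mathrm{vol}(\mathrm{D}(x,y))$ for all $a\in\mathbb{R}_{>0}$. (d) $\displaystyle \Big(x\frac{\partial}{\partial x}-y\frac{\partial}{\partial y}\Big)\mathrm{vol}(\mathrm{D}(x,y)) = 0$. (e) $\displaystyle \Big(\frac{\partial}{\partial x}\frac{\partial}{\partial y}-1\Big)\mathrm{vol}(\mathrm{D}(x,y)) = 0$. (f) $\mathrm{vol}(\mathrm{D}(x,y)) = I_0(2\sqrt{xy})$, and $I_0(z)=\mathrm{vol}(\mathrm{D}(\frac z2,\frac z2))$ for $z>0$.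
   Context: For $x>0$ and $k\geq 1$, $\Delta^k_x=\{(x_1,\dots,x_k)\in\mathbb{R}^k : 0\leq x_1\leq\cdots\leq x_k\leq x\}$ with Lebesgue measure; $\Delta^0_x$ is a single point, of volume $1$. For $x,y>0$ and $n\geq 1$, $\mathrm{D}_n(x,y)$ is the space of continuous diagrams (left-aligned stairs) of width $x$, height $y$ with $n$ blocks: it is the set of diagrams bounded by $2n$-step alternating east-north directed paths from $(0,0)$ to $(x,y)$ (first step east, last step north, steps of arbitrary nonnegative real length). It is identified with $\Delta^{n-1}_x\times\Delta^{n-1}_y$, the point $(x_1,\dots,x_{n-1};y_1,\dots,y_{n-1})$ corresponding to the path $p_0,\dots,p_{2n}$ with $p_{2i-1}=(x_i,y_{i-1})$, $p_{2i}=(x_i,y_i)$, where $x_0=y_0=0$, $x_n=x$, $y_n=y$; its volume is the $(2n-2)$-dimensional Lebesgue volume of $\Delta^{n-1}_x\times\Delta^{n-1}_y$. $\mathrm{D}(x,y)=\bigsqcup_{n\geq1}\mathrm{D}_n(x,y)$, and $\mathrm{vol}(\mathrm{D}(x,y))=\sum_{n=1}^\infty \mathrm{vol}(\mathrm{D}_n(x,y))$. The modified Bessel functions are, for $\nu\in\mathbb{N}$ (including $0$), $I_\nu(z)=(\tfrac z2)^\nu\sum_{k=0}^\infty\frac{(z/2)^{2k}}{k!\,(\nu+k)!}$. *)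

(* Defs.v *)
From HB Require Import structures.
From mathcomp Require Import all_boot all_order all_algebra.
From mathcomp Require Import all_classical all_reals all_analysis.

Set Implicit Arguments.
Unset Strict Implicit.
Unset Printing Implicit Defensive.

Import Order.TTheory GRing.Theory Num.Theory.
Import numFieldNormedType.Exports.

Local Open Scope classical_set_scope.
Local Open Scope ring_scope.

(* Lebesgue measure on R^k (Borel sets), R^k being k.-tuple R: the pushforward
   of the product measure on R * R^(k-1) under (t, v) |-> t :: v; on R^0 it is
   the unit mass at the only point. *)
Fixpoint lebesgue_tuple (R : realType) (k : nat) :
    set (k.-tuple (measurableTypeR R)) -> \bar R :=
  match k with
  | 0 => dirac [tuple]
  | k'.+1 => pushforward
      (product_measure1 (@lebesgue_measure R) (@lebesgue_tuple R k'))
      (fun p : measurableTypeR R * k'.-tuple (measurableTypeR R) =>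
         [tuple of p.1 :: p.2])
  end.
Arguments lebesgue_tuple R k : clear implicits.

Section lebesgue_tuple_measure.
Local Open Scope ereal_scope.
Variable R : realType.
Local Notation mR := (measurableTypeR R).

Let measurable_tcons k :
  measurable_fun setT (fun p : mR * k.-tuple mR => [tuple of p.1 :: p.2]).
Proof. exact: measurable_cons. Qed.

Let lebesgue_tuple_sfm k :
  exists m : {sigma_finite_measure set (k.-tuple mR) -> \bar R},
    (m : set (k.-tuple mR) -> \bar R) = lebesgue_tuple R k.
Proof.
elim: k => [|k [m mE]]; first by exists (dirac [tuple]).
pose mu : {measure set (k.+1.-tuple mR) -> \bar R} :=
  measure_function_pushforward__canonical__measure_function_Measure
    (product_measure1 (@lebesgue_measure R) m) (@measurable_tcons k).
have muT : sigma_finite setT mu.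
  have /sigma_finiteP[F [FT ndF Foo]] := sigma_finiteT (@lebesgue_measure R).
  have /sigma_finiteP[G [GT ndG Goo]] := sigma_finiteT m.
  pose ucons (v : k.+1.-tuple mR) : mR * k.-tuple mR :=
    (thead v, [tuple of behead v]).
  have mucons : measurable_fun setT ucons.
    apply: measurable_fun_pair; last exact: measurable_behead.
    exact: (@measurable_tnth _ _ _ ord0).
  exists (fun n => ucons @^-1` (F n `*` G n)).
    apply/esym/seteqP; split => // v _.
    have [i _ Fi] : (\bigcup_i F i) (thead v) by rewrite -FT.
    have [j _ Gj] : (\bigcup_i G i) [tuple of behead v] by rewrite -GT.
    exists (maxn i j) => //; split => /=.
      by move: Fi; exact/subsetPset/ndF/leq_maxl.
    by move: Gj; exact/subsetPset/ndG/leq_maxr.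
  move=> n; have [mF Fn] := Foo n; have [mG Gn] := Goo n; split.
    rewrite -[X in measurable X]setTI; apply: mucons => //.
    exact: measurableX.
  rewrite /mu/= /pushforward.
  suff -> : (fun p : mR * k.-tuple mR => [tuple of p.1 :: p.2]) @^-1`
     (ucons @^-1` (F n `*` G n)) = F n `*` G n.
    by rewrite product_measure1E// lte_mul_pinfty// ge0_fin_numE.
  apply/funext => -[t v].
  transitivity ((F n `*` G n) (ucons [tuple of t :: v])) => //.
  congr (setX _ _ _); rewrite /ucons theadE.
  by congr (_, _); exact/val_inj.
pose b := @Measure_isSigmaFinite.Build _ _ R mu muT.
pose mu' : {sigma_finite_measure set (k.+1.-tuple mR) -> \bar R} :=
  HB.pack (mu : set _ -> \bar R) (Measure.class mu) b.
by exists mu'; rewrite /= -mE.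
Qed.

Let lebesgue_tuple0 k : lebesgue_tuple R k set0 = 0.
Proof. by have [m <-] := lebesgue_tuple_sfm k; exact: measure0. Qed.

Let lebesgue_tuple_ge0 k A : 0 <= lebesgue_tuple R k A.
Proof. by have [m <-] := lebesgue_tuple_sfm k; exact: measure_ge0. Qed.

Let lebesgue_tuple_sigma_additive k : semi_sigma_additive (lebesgue_tuple R k).
Proof.
by have [m <-] := lebesgue_tuple_sfm k; exact: measure_semi_sigma_additive.
Qed.

HB.instance Definition _ k := isMeasure.Build _ _ _ (lebesgue_tuple R k)
  (@lebesgue_tuple0 k) (@lebesgue_tuple_ge0 k)
  (@lebesgue_tuple_sigma_additive k).

Let sigma_finite_lebesgue_tuple k : sigma_finite setT (lebesgue_tuple R k).
Proof.
by have [m <-] := lebesgue_tuple_sfm k; exact: sigma_finiteT.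
Qed.

HB.instance Definition _ k := Measure_isSigmaFinite.Build _ _ _
  (lebesgue_tuple R k) (@sigma_finite_lebesgue_tuple k).

Lemma lebesgue_tuple_box k (A : 'I_k -> set mR) :
  (forall i, measurable (A i)) ->
  lebesgue_tuple R k [set v | forall i, A i (tnth v i)] =
  \prod_(i < k) lebesgue_measure (A i).
Proof.
elim: k A => [|k IH] A mA.
  rewrite big_ord0 /= /dirac indicE mem_set//= => -[]//.
rewrite big_ord_recl -IH// -product_measure1E//.
- rewrite /= /pushforward; congr (product_measure1 _ _ _).
  apply/seteqP; split => -[t v] /=.
    move=> H; split; first by have := H ord0; rewrite tnth0.
    by move=> i; have := H (lift ord0 i); rewrite tnthS.
  move=> [H0 H] i; have [j ->|->] := unliftP ord0 i; last by rewrite tnth0.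
  by rewrite tnthS.
- rewrite (_ : [set _ | _] =
    \bigcap_(i in [set: 'I_k]) ((tnth (T:=mR))^~ i @^-1` A (lift ord0 i))).
    apply: fin_bigcap_measurable => // i _.
    rewrite -[X in measurable X]setTI; exact: measurable_tnth.
  by apply/seteqP; split => v /= H i; first move=> _; exact: H.
Qed.

End lebesgue_tuple_measure.

(* 0 <= x_1 <= ... <= x_k <= x *)
Definition simplex (R : realType) (k : nat) (x : R) :
    set (k.-tuple (measurableTypeR R)) :=
  [set v | path <=%R (0 : R) (rcons v x)].
Arguments simplex {R} k x.

Section diagrams.
Variable R : realType.
Local Notation mR := (measurableTypeR R).

(* Coordinates (x_1, ..., x_(n-1); y_1, ..., y_(n-1)) of the stairs with n
   blocks. *)
Definition stair_coord (n : nat) : Type :=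
  (n.-1.-tuple mR * n.-1.-tuple mR)%type.

Definition diagrams_n (n : nat) (x y : R) : set (stair_coord n) :=
  simplex n.-1 x `*` simplex n.-1 y.
Arguments diagrams_n n x y : clear implicits.

(* The corners p_0, ..., p_(2n) of alternating east-north paths from (0, 0) to
   (x, y); the theorem stair_path_bij below identifies diagrams_n with them. *)
Definition stairs (n : nat) (x y : R) : set (n.*2.+1.-tuple (R * R)) :=
  [set p | [/\ nth 0 p 0 = (0, 0),
    forall i, (i < n)%N ->
      (nth 0 p i.*2).1 <= (nth 0 p i.*2.+1).1 /\
      (nth 0 p i.*2).2 = (nth 0 p i.*2.+1).2,
    forall i, (i < n)%N ->
      (nth 0 p i.*2.+1).1 = (nth 0 p i.*2.+2).1 /\
      (nth 0 p i.*2.+1).2 <= (nth 0 p i.*2.+2).2 &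
    nth 0 p n.*2 = (x, y)]].
Arguments stairs n x y : clear implicits.

(* p_(2i-1) = (x_i, y_(i-1)) and p_(2i) = (x_i, y_i) where x_0 = y_0 = 0,
   x_n = x and y_n = y. *)
Definition stair_path (n : nat) (x y : R) (c : stair_coord n) :
    n.*2.+1.-tuple (R * R) :=
  [tuple (nth 0 (0 :: rcons (c.1 : seq R) x) (uphalf j),
          nth 0 (0 :: rcons (c.2 : seq R) y) j./2) | j < n.*2.+1].

(* The disjoint union over n >= 1. *)
Definition diagram : Type := {n : nat & stair_coord n}.

Definition diagrams (x y : R) : set diagram :=
  [set d | (0 < tag d)%N /\ diagrams_n (tag d) x y (tagged d)].

Definition vol (A : set diagram) : \bar R :=
  (\sum_(1 <= n <oo)
     product_measure1 (lebesgue_tuple R n.-1) (lebesgue_tuple R n.-1)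
       [set c : stair_coord n | A (Tagged stair_coord c)])%E.

Definition partial_x (F : R -> R -> R) (x y : R) : R :=
  derive1 (fun t => F t y) x.
Definition partial_y (F : R -> R -> R) (x y : R) : R :=
  derive1 (fun t => F x t) y.

Definition besselI (nu : nat) (z : R) : R :=
  (z / 2) ^+ nu *
  limn (series (fun k => (z / 2) ^+ (2 * k) / (k`!%:R * (nu + k)`!%:R))).

Lemma vol_diagrams x y : vol (diagrams x y) =
  (\sum_(1 <= n <oo)
     product_measure1 (lebesgue_tuple R n.-1) (lebesgue_tuple R n.-1)
       (simplex n.-1 x `*` simplex n.-1 y))%E.
Proof.
rewrite /vol; congr (limn _); apply/funext => N.
apply: eq_big_nat => n /andP[n0 _]; congr (product_measure1 _ _ _).
by apply/seteqP; split => c => [[]//|cD]; split.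
Qed.

Lemma is_cvg_besselI nu z :
  cvgn (series (fun k => (z / 2) ^+ (2 * k) / (k`!%:R * (nu + k)`!%:R) : R)).
Proof.
apply: (@series_le_cvg _ _ (exp_coeff ((z / 2) ^+ 2))).
- move=> k; apply: divr_ge0; last by rewrite mulr_ge0.
  by rewrite exprM exprn_ge0// sqr_ge0.
- by move=> k; apply: exp_coeff_ge0; rewrite sqr_ge0.
- move=> k; rewrite /exp_coeff /= exprM; apply: ler_wpM2l.
    by rewrite exprn_ge0// sqr_ge0.
  rewrite lef_pV2 ?posrE ?mulr_gt0 ?ltr0n ?fact_gt0//.
  by rewrite ler_peMr ?ler0n// ler1n fact_gt0.
- exact: is_cvg_series_exp_coeff.
Qed.

Let nth_stair_path n x y (c : stair_coord n) j : (j <= n.*2)%N ->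
  nth 0 (stair_path x y c) j =
  (nth 0 (0 :: rcons (c.1 : seq R) x) (uphalf j),
   nth 0 (0 :: rcons (c.2 : seq R) y) j./2).
Proof.
by rewrite -ltnS => jn; rewrite -(tnth_nth 0 _ (Ordinal jn)) tnth_mktuple.
Qed.

Let nth_stair_path_even n x y (c : stair_coord n) i : (i <= n)%N ->
  nth 0 (stair_path x y c) i.*2 =
  (nth 0 (0 :: rcons (c.1 : seq R) x) i, nth 0 (0 :: rcons (c.2 : seq R) y) i).
Proof.
by move=> ?; rewrite nth_stair_path ?leq_double// uphalf_double doubleK.
Qed.

Let nth_stair_path_odd n x y (c : stair_coord n) i : (i < n)%N ->
  nth 0 (stair_path x y c) i.*2.+1 =
  (nth 0 (0 :: rcons (c.1 : seq R) x) i.+1,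
   nth 0 (0 :: rcons (c.2 : seq R) y) i).
Proof.
move=> ?; rewrite nth_stair_path ?ltn_double//.
have -> : uphalf i.*2.+1 = i.+1 by rewrite -[RHS]doubleK.
by have -> : i.*2.+1./2 = i by rewrite -[RHS]uphalf_double.
Qed.

Let in_simplexP m (x : R) (u : m.-tuple mR) :
  simplex m x u <-> forall i, (i < m.+1)%N ->
    nth (0 : R) (0 :: rcons (u : seq R) x) i <=
    nth (0 : R) (0 :: rcons (u : seq R) x) i.+1.
Proof.
rewrite /simplex /=; split => [/(pathP (0 : R))|H].
  by rewrite size_rcons size_tuple => H i im; exact: H.
by apply/(pathP (0 : R)); rewrite size_rcons size_tuple => i im; exact: H.
Qed.

Let nth_last_corner m (x : R) (u : m.-tuple mR) :
  nth (0 : R) (0 :: rcons (u : seq R) x) m.+1 = x.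
Proof. by rewrite /= nth_rcons size_tuple ltnn eqxx. Qed.

Let nth_inner_corner m (x : R) (u : m.-tuple mR) i : (i < m)%N ->
  nth (0 : R) (0 :: rcons (u : seq R) x) i.+1 = nth (0 : R) u i.
Proof. by move=> im; rewrite /= nth_rcons size_tuple im. Qed.

Theorem stair_path_bij n x y : (0 < n)%N ->
  set_bij (diagrams_n n x y) (stairs n x y) (@stair_path n x y).
Proof.
case: n => // m _; split.
- move=> c [/in_simplexP Hu /in_simplexP Hv]; split.
  + by rewrite (nth_stair_path_even _ _ _ (leq0n _)).
  + move=> i im; rewrite nth_stair_path_even 1?ltnW// nth_stair_path_odd//.
    by split => //; exact: Hu.
  + move=> i im; rewrite -doubleS nth_stair_path_even// nth_stair_path_odd//.
    by split => //; exact: Hv.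
  + by rewrite nth_stair_path_even// !nth_last_corner.
- move=> c d _ _ cd; apply/eqP; rewrite -pair_eqE; apply/andP; split.
  + apply/eqP/val_inj/(@eq_from_nth _ (0 : R)); rewrite ?size_tuple// => i im.
    have := congr1
      (fun p : m.+1.*2.+1.-tuple (R * R) => (nth 0 p i.*2.+1).1) cd.
    by rewrite !nth_stair_path_odd ?(leqW im)// !nth_inner_corner.
  + apply/eqP/val_inj/(@eq_from_nth _ (0 : R)); rewrite ?size_tuple// => i im.
    have := congr1
      (fun p : m.+1.*2.+1.-tuple (R * R) => (nth 0 p i.+1.*2).2) cd.
    by rewrite !nth_stair_path_even ?(leqW im)// !nth_inner_corner.
- move=> p [p0 peast pnorth pend].
  pose u : m.-tuple mR := [tuple (nth 0 p i.*2.+1).1 | i < m].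
  pose v : m.-tuple mR := [tuple (nth 0 p i.*2.+2).2 | i < m].
  have nu i : (i < m.+1)%N ->
      nth (0 : R) (0 :: rcons (u : seq R) x) i.+1 = (nth 0 p i.*2.+1).1.
    rewrite ltnS leq_eqVlt => /predU1P[->|im].
      by rewrite nth_last_corner (pnorth m _).1// -doubleS pend.
    by rewrite nth_inner_corner// -(tnth_nth 0 u (Ordinal im)) tnth_mktuple.
  have nv i : (i <= m.+1)%N ->
      nth (0 : R) (0 :: rcons (v : seq R) y) i = (nth 0 p i.*2).2.
    case: i => [_|i]; first by rewrite p0.
    rewrite ltnS leq_eqVlt => /predU1P[->|im].
      by rewrite nth_last_corner pend.
    by rewrite nth_inner_corner// -(tnth_nth 0 v (Ordinal im)) tnth_mktuple.
  have nu' i : (i <= m.+1)%N ->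
      nth (0 : R) (0 :: rcons (u : seq R) x) i = (nth 0 p i.*2).1.
    case: i => [_|i im]; first by rewrite p0.
    by rewrite nu// (pnorth i im).1.
  exists (u, v).
    split.
    + apply/(@in_simplexP m x u) => i im.
      by rewrite nu// nu' ?(ltnW im)//; exact: (peast i im).1.
    + apply/(@in_simplexP m y v) => i im; rewrite !nv ?(ltnW im)//.
      by rewrite (peast i im).2; exact: (pnorth i im).2.
  apply/val_inj/(@eq_from_nth _ 0); rewrite ?size_tuple// => j jm.
  rewrite -[j]odd_double_half; case: (boolP (odd j)) => oj.
  + have jlt : (j./2 < m.+1)%N.
      rewrite -ltn_double -ltnS -[X in (_.+1 < X)%N]/(m.+1.*2.+1).
      by rewrite (leq_trans _ jm)// -[X in (_ <= X.+1)%N]odd_double_half oj.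
    rewrite add1n nth_stair_path_odd// nu// nv ?(ltnW jlt)//.
    by rewrite (peast _ jlt).2 -surjective_pairing.
  + have jle : (j./2 <= m.+1)%N.
      rewrite -leq_double -ltnS (leq_trans _ jm)// ltnS.
      by rewrite -[X in (_ <= X)%N]odd_double_half leq_addl.
    by rewrite add0n nth_stair_path_even// nu'// nv// -surjective_pairing.
Qed.

End diagrams.

Arguments diagrams_n {R} n x y.
Arguments stairs {R} n x y.

(* Main.v *)
(* The simplex of dimension k and side x has volume x^k / k!, by slicing along
   the first coordinate, so vol(D(x, y)) = G_0(x y) where
   G_k(u) = sum_n u^n / (n! (k + n)!). Differentiating termwise gives
   G_k' = G_(k+1), and comparing coefficients gives
   u G_2(u) + G_1(u) = G_0(u), i.e. (u G_0')' = G_0, which is (e). All the other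
   claims hold because the volume depends on x y only. *)

Require Import Defs.
From mathcomp Require Import all_boot all_order all_algebra.
From mathcomp Require Import all_classical all_reals all_analysis.
From mathcomp Require Import ring.

Import Order.TTheory GRing.Theory Num.Theory.
Import numFieldNormedType.Exports.

Local Open Scope classical_set_scope.
Local Open Scope ring_scope.

(** * Measurability and volume of the simplex *)

Lemma le_path_rcons (R : realType) (a x : R) (s : seq R) :
  path <=%R a (rcons s x) -> a <= x.
Proof.
move=> /(order_path_min le_trans)/allP; apply.
by rewrite mem_rcons mem_head.
Qed.

Lemma measurable_nth_path (R : realType) (k : nat) (a x : R) (i : nat) :
  measurable_fun setT (fun v : k.-tuple (measurableTypeR R) =>
    nth (0 : R) (a :: rcons (v : seq R) x) i : measurableTypeR R).
Proof.
case: i => [|i] /=; first exact: measurable_cst.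
have [ik|ki|->] := ltngtP i k.
- under eq_fun => v do
    rewrite nth_rcons size_tuple ik -(tnth_nth 0 v (Ordinal ik)).
  exact: measurable_tnth.
- under eq_fun => v do rewrite nth_rcons size_tuple ltnNge (ltnW ki) gtn_eqF//=.
  exact: measurable_cst.
- under eq_fun => v do rewrite nth_rcons size_tuple ltnn eqxx.
  exact: measurable_cst.
Qed.

(** Only neighbours need comparing: the set is an intersection of [k.+1] conditions, each an
    inequality between measurable functions. *)
Lemma measurable_path_le (R : realType) (k : nat) (a x : R) :
  measurable [set v : k.-tuple (measurableTypeR R) |
    path <=%R a (rcons (v : seq R) x)].
Proof.
rewrite (_ : [set _ | _] = \bigcap_(i in [set i | (i < k.+1)%N])
    [set v : k.-tuple (measurableTypeR R) |
      nth (0 : R) (a :: rcons (v : seq R) x) i <=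
      nth (0 : R) (a :: rcons (v : seq R) x) i.+1]).
  apply: bigcap_measurableType => i _.
  rewrite -[X in measurable X]setTI.
  by apply: measurable_fun_le => //; exact: measurable_nth_path.
apply/seteqP; split => v /=.
  by move=> /(pathP (0 : R)); rewrite size_rcons size_tuple => H i /= /H.
by move=> H; apply/(pathP (0 : R)); rewrite size_rcons size_tuple => i /H.
Qed.

Lemma is_derive_pow_fact (R : realType) (k : nat) (x t : R) :
  is_derive t (1 : R) (fun t => (x - t) ^+ k.+1 / k.+1`!%:R)
    (- ((x - t) ^+ k / k`!%:R)).
Proof.
have -> : - ((x - t) ^+ k / k`!%:R) =
    k.+1`!%:R^-1 *: ((k.+1%:R * (x - t) ^+ k) *: (0 - 1 : R)).
  rewrite /GRing.scale/= sub0r factS natrM; field.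
  by rewrite nat1r !pnatr_eq0 /= -lt0n fact_gt0.
have -> : (fun t => (x - t) ^+ k.+1 / k.+1`!%:R) =
    k.+1`!%:R^-1 \*: ((cst x - id : R -> R) ^+ k.+1).
  by apply/funext => u; rewrite /= mulrC fctE.
exact/is_deriveZ/is_deriveX.
Qed.

Lemma integral_pow_fact (R : realType) (k : nat) (a x : R) : a <= x ->
  (\int[@lebesgue_measure R]_(t in `[a, x]) ((x - t) ^+ k / k`!%:R)%:E =
   ((x - a) ^+ k.+1 / k.+1`!%:R)%:E)%E.
Proof.
(* The fundamental theorem of calculus is applied for [a < x]; at [a = x] both sides vanish. *)
rewrite le_eqVlt => /predU1P[->|ax].
  by rewrite set_itv1 integral_set1 subrr expr0n mul0r.
pose F (t : R) : R := - ((x - t) ^+ k.+1 / k.+1`!%:R).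
have dF t : is_derive t (1 : R) F ((x - t) ^+ k / k`!%:R).
  rewrite -[X in is_derive _ _ _ X]opprK.
  exact/is_deriveN/is_derive_pow_fact.
have cF t : {for t, continuous F}.
  by apply/differentiable_continuous/derivable1_diffP.
rewrite (@continuous_FTC2 _ (fun t => (x - t) ^+ k / k`!%:R) F).
- by rewrite /F subrr expr0n mul0r oppr0 sub0e -EFinN opprK.
- exact: ax.
- apply: continuous_subspaceT => t.
  apply: cvgMl.
  apply: (@continuous_comp _ _ _ (fun t => x - t) (fun u => u ^+ k)).
    by apply: cvgB; [exact: cvg_cst|exact: cvg_id].
  exact: exprn_continuous.
- split; first by move=> t _; exact: ex_derive.
    exact/cvg_at_right_filter/cF.
  exact/cvg_at_left_filter/cF.
- by move=> t _; rewrite derive1E; apply: derive_val.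
Qed.

(* Slicing along the first coordinate replaces the lower bound [a] by that
   coordinate, which is why the simplex is allowed to start at any [a]. *)
Lemma lebesgue_tuple_path (R : realType) (k : nat) (a x : R) : a <= x ->
  lebesgue_tuple R k [set v | path <=%R a (rcons (v : seq R) x)] =
  ((x - a) ^+ k / k`!%:R)%:E.
Proof.
elim: k a => [|k IH] a ax.
  rewrite /= /dirac indicE mem_set ?expr0 ?divr1//=.
  by rewrite ax.
rewrite -integral_pow_fact// /= /pushforward /product_measure1.
(* Extending the integrand by zero turns both sides into integrals over the whole line, so it
   suffices to compare the slices at each [t]. *)
rewrite [RHS]integral_mkcond.
apply: eq_integral => t _; rewrite patchE /=.
case: ifPn => [|].
  rewrite inE /= in_itv /= => /andP[at' tx]; rewrite -IH//.
  congr (lebesgue_tuple R k _); apply/seteqP; split => v; rewrite /xsection /=.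
    by rewrite inE /= => /andP[].
  by rewrite inE /= at'.
(* Outside [[a, x]] the slice is empty: a chain through [t] forces [a <= t <= x]. *)
rewrite notin_setE /= in_itv /= => /negP Nt.
rewrite (_ : xsection _ _ = set0) ?measure0//.
apply/seteqP; split => v //; rewrite /xsection /= inE /= => /andP[at' pt].
by case: Nt; rewrite at' /= (le_path_rcons _ _ _ _ pt).
Qed.

(** * The power series behind the Bessel functions *)

Definition bessel_coef (R : realType) (k n : nat) : R :=
  (n`!%:R * (k + n)`!%:R)^-1.
Arguments bessel_coef {R} k n.

(* [I_k(z) = (z / 2)^k * bessel_series k ((z / 2)^2)] *)
Definition bessel_series (R : realType) (k : nat) (u : R) : R :=
  limn (pseries (bessel_coef k) u).
Arguments bessel_series {R} k u.

Lemma pseries_diffs_bessel_coef (R : realType) (k : nat) :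
  pseries_diffs (bessel_coef k) = bessel_coef k.+1 :> (R^nat).
Proof.
apply/funext => n; rewrite /pseries_diffs /bessel_coef factS addnS addSn natrM.
by rewrite -mulrA invfM mulVKf// pnatr_eq0.
Qed.

(** This is the convergence of the series in [besselI] at [z = 2 * Num.sqrt u], where
    [(z / 2) ^+ 2 = u]; taking the root requires [0 <= u]. *)
Lemma is_cvg_bessel_series (R : realType) (k : nat) (u : R) : 0 <= u ->
  cvgn (pseries (bessel_coef k) u).
Proof.
move=> u0; have := @is_cvg_besselI R k (2 * Num.sqrt u).
rewrite (mulrC 2) mulfK ?pnatr_eq0//.
under [X in series X]eq_fun do rewrite exprM sqr_sqrtr// mulrC.
exact.
Qed.

Lemma besselI0E (R : realType) (z : R) :
  besselI 0 z = bessel_series 0 ((z / 2) ^+ 2).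
Proof.
rewrite /besselI expr0 mul1r /bessel_series /pseries /bessel_coef.
by under eq_fun do rewrite exprM mulrC.
Qed.

Lemma is_derive_bessel_series (R : realType) (k : nat) (u : R) : 0 <= u ->
  is_derive u (1 : R) (bessel_series k) (bessel_series k.+1 u).
Proof.
move=> u0; rewrite /bessel_series -pseries_diffs_bessel_coef.
have u1 : 0 <= u + 1 by rewrite addr_ge0.
(* Termwise differentiation at [u] needs convergence at some point of larger absolute value; [u + 1]
   serves. *)
apply: (@pseries_snd_diffs _ _ (u + 1)); rewrite ?pseries_diffs_bessel_coef;
  try exact: is_cvg_bessel_series.
by rewrite !ger0_norm// ltrDl.
Qed.

(* The Bessel equation for [bessel_series k], written with its derivatives
   [bessel_series k.+1] and [bessel_series k.+2]. *)
Lemma bessel_series_rec (R : realType) (k : nat) (u : R) : 0 <= u ->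
  u * bessel_series k.+2 u + k.+1%:R * bessel_series k.+1 u =
  bessel_series k u.
Proof.
move=> u0; rewrite /bessel_series.
have c k' := is_cvg_bessel_series R k' u u0.
(* This writes the derivative with terms [n * c_n * u ^+ n.-1], so that after multiplication by [u]
   the partial sums of both sides agree term by term. *)
have := @pseries_diffs_equiv R (bessel_coef k.+1) u.
rewrite pseries_diffs_bessel_coef => /(_ (c _))/(cvgM (cvg_cst u))/cvgD.
move=> /(_ _ _ (cvgM (cvg_cst (k.+1%:R : R)) (c k.+1)))/cvg_lim <-//.
congr (limn _); apply/funext => n; rewrite /GRing.add /=.
rewrite /series /= !mulr_sumr -big_split/=.
apply: eq_bigr => i _.
transitivity ((k.+1 + i)%:R * bessel_coef k.+1 i * u ^+ i).
  (* At [i = 0] the exponent [i.-1] is 0 rather than -1, but the factor [i] kills the term. *)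
  rewrite natrD; case: i => [|i].
    by rewrite !mul0r mulr0 expr0; ring.
  by rewrite exprS; ring.
by rewrite /bessel_coef addSn factS natrM mulrCA invfM mulVKf ?pnatr_eq0//.
Qed.

(** * Volume of the space of diagrams and its derivatives *)

Lemma lebesgue_tuple_simplex (R : realType) (k : nat) (x : R) : 0 <= x ->
  lebesgue_tuple R k (simplex k x) = (x ^+ k / k`!%:R)%:E.
Proof. by move=> x0; rewrite /simplex lebesgue_tuple_path// subr0. Qed.

Lemma vol_diagrams_series (R : realType) (x y : R) : 0 <= x -> 0 <= y ->
  vol (diagrams x y) =
  (\sum_(0 <= n <oo) (x ^+ n * y ^+ n / (n`!%:R * n`!%:R))%:E)%E.
Proof.
(* Shifting the index by one turns the dimension [n.-1], for [n >= 1], into [n], for [n >= 0]. *)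
move=> x0 y0; rewrite vol_diagrams -nneseries_addn; last first.
  by move=> n; exact: integral_ge0.
apply: eq_eseriesr => n _; rewrite addn1 /=.
rewrite product_measure1E; try exact: measurable_path_le.
rewrite [X in (X * _)%E]lebesgue_tuple_simplex//.
rewrite [X in (_ * X)%E]lebesgue_tuple_simplex//.
by rewrite -EFinM invfM mulrACA.
Qed.

Lemma vol_bessel_series (R : realType) (x y : R) : 0 <= x -> 0 <= y ->
  vol (diagrams x y) = (bessel_series 0 (x * y))%:E.
Proof.
move=> x0 y0; rewrite vol_diagrams_series// /bessel_series.
rewrite -EFin_lim; last first.
  by apply: is_cvg_bessel_series; exact: mulr_ge0.
congr (limn _); apply/funext => N /=; rewrite /pseries /series /= -sumEFin.
by apply: eq_bigr => n _; rewrite exprMn mulrC.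
Qed.

Lemma is_derive_bessel_scale (R : realType) (k : nat) (a s : R) :
  0 <= a -> 0 <= s ->
  is_derive s (1 : R) (fun s => bessel_series k (s * a))
    (a * bessel_series k.+1 (s * a)).
Proof.
move=> a0 s0; have H := is_derive_bessel_series R k (s * a) (mulr_ge0 s0 a0).
have L : is_derive s (1 : R) (fun s => s * a) a.
  rewrite (_ : (fun s => s * a) = a \*: (id : R -> R)); last first.
    by apply/funext => t; rewrite /= mulrC.
  by rewrite -[X in is_derive _ _ _ X]mulr1; apply: is_deriveZ.
by rewrite mulrC; exact: is_derive1_comp.
Qed.

Theorem theorem14 (R : realType) (x y : R) (hx : 0 < x) (hy : 0 < y) :
  let V : R -> R -> R := fun s t => fine (vol (diagrams s t)) in
  (* (a) *)
  (vol (diagrams x y) \is a fin_num /\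
   vol (diagrams x y) =
     (\sum_(0 <= n <oo) (x ^+ n * y ^+ n / (n`!%:R * n`!%:R))%:E)%E) /\
  (* (b) *)
  vol (diagrams x y) = vol (diagrams y x) /\
  (* (c) *)
  (forall a : R, 0 < a ->
     vol (diagrams (a * x) (a^-1 * y)) = vol (diagrams x y)) /\
  (* (d) *)
  (derivable (fun s => V s y) x 1 /\ derivable (fun t => V x t) y 1 /\
   x * partial_x V x y - y * partial_y V x y = 0) /\
  (* (e) *)
  (derivable (fun s => partial_y V s y) x 1 /\
   partial_x (partial_y V) x y - V x y = 0) /\
  (* (f) *)
  (vol (diagrams x y) = (besselI 0 (2 * Num.sqrt (x * y)))%:E /\
   forall z : R, 0 < z ->
     (besselI 0 z)%:E = vol (diagrams (z / 2) (z / 2))).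
Proof.
move=> V.
have VE (s t : R) : 0 <= s -> 0 <= t -> V s t = bessel_series 0 (s * t).
  by move=> s0 t0; rewrite /V vol_bessel_series.
have dVx (s t : R) : 0 < s -> 0 < t ->
    is_derive s (1 : R) (V ^~ t) (t * bessel_series 1 (s * t)).
  move=> s0 t0; have := is_derive_bessel_scale R 0 t s (ltW t0) (ltW s0).
  (* [VE] covers nonnegative sides only, so the derivative is transferred through equality on a
     neighbourhood of [s] inside the positive reals. *)
  apply: near_eq_is_derive; near=> s'; apply/esym/VE; last exact: ltW.
  by near: s'; apply: filterS (lt_nbhsr s0) => ? /ltW.
have dVy (s t : R) : 0 < s -> 0 < t ->
    is_derive t (1 : R) (V s) (s * bessel_series 1 (t * s)).
  move=> s0 t0; have := is_derive_bessel_scale R 0 s t (ltW s0) (ltW t0).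
  apply: near_eq_is_derive; near=> t'.
  rewrite mulrC; apply/esym/VE; first exact: ltW.
  by near: t'; apply: filterS (lt_nbhsr t0) => ? /ltW.
have VxE : partial_x V x y = y * bessel_series 1 (x * y).
  rewrite /partial_x derive1E.
  by rewrite (@derive_val _ _ _ _ _ _ _ (dVx _ _ hx hy)).
have VyE (s : R) : 0 < s -> partial_y V s y = s * bessel_series 1 (s * y).
  move=> s0; rewrite /partial_y derive1E (mulrC s y).
  by rewrite (@derive_val _ _ _ _ _ _ _ (dVy _ _ s0 hy)).
(* With [G_k] for [bessel_series k], the product rule on [s * G_1(s * y)] gives
   [x * y * G_2(x * y) + G_1(x * y)], which is [G_0(x * y)] by the recurrence at [k = 0]. *)
have dVyx : is_derive x (1 : R) (partial_y V ^~ y) (V x y).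
  have : is_derive x (1 : R) (id * (fun s => bessel_series 1 (s * y)) : R -> R)
      (V x y).
    have H := is_derive_bessel_scale R 1 y x (ltW hy) (ltW hx).
    apply: (is_derive_eq (is_deriveM (is_derive_id x 1) H)).
    rewrite VE ?ltW// -(bessel_series_rec _ 0) ?mulr_ge0 ?ltW//.
    by rewrite /GRing.scale /= mulr1 mul1r mulrA.
  apply: near_eq_is_derive; near=> s; apply/esym/VyE.
  by near: s; exact: lt_nbhsr.
have xy0 : 0 <= x * y by rewrite mulr_ge0 ?ltW.
split; [split|split; [|split; [|split; [|split]]]].
- by rewrite vol_bessel_series ?ltW.
- by rewrite vol_diagrams_series ?ltW.
- by rewrite !vol_bessel_series ?ltW// mulrC.
- move=> a a0.
  rewrite !vol_bessel_series ?mulr_ge0 ?invr_ge0 ?ltW//.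
  by rewrite mulrACA mulfV ?gt_eqF// mul1r.
- split; first by have [] := dVx _ _ hx hy.
  split; first by have [] := dVy _ _ hx hy.
  by rewrite VxE VyE// mulrCA subrr.
- split; first by have [] := dVyx.
  by rewrite /partial_x derive1E (@derive_val _ _ _ _ _ _ _ dVyx) subrr.
- split => [|z z0].
    rewrite vol_bessel_series ?ltW// besselI0E (mulrC 2) mulfK ?pnatr_eq0//.
    by rewrite sqr_sqrtr.
  have z2 : 0 <= z / 2 by rewrite divr_ge0// ltW.
  by rewrite vol_bessel_series// besselI0E expr2.
Unshelve. all: by end_near. Qed.
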